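(* Let $\rho\neq\delta_0$ be a Borel probability measure on $\mathbb{R}_+$ and let $p\ge 2$ be an integer with $m_k(\rho)=\int x^k\rho(dx)<\infty$ for $k=0,\dots,p$. Write $\mathrm{Var}(\rho)=m_2(\rho)-m_1(\rho)^2$. (1) The $S$-transform of $\rho$ admits an expansion \[ S_\rho(z)=\sum_{k=0}^{p-1}s_k(\rho)z^{k}+o(z^{p-1})\qquad\text{as } z\to0,\ z\in\mathfrak{D}_\rho, \] with $s_0(\rho)=\frac1{m_1(\rho)}$ and $s_1(\rho)=\frac1{m_1(\rho)}-\frac{m_2(\rho)}{m_1(\rho)^3}=-\frac{\mathrm{Var}(\rho)}{m_1(\rho)^3}$. (2) The $\Sigma$-transform of $\rho$ admits an expansion \[ \Sigma_\rho(z)=\sum_{k=0}^{p-1}\sigma_k(\rho)z^{k}+o(z^{p-1})\qquad\text{as } z\to0 \text{ with } z/(1-z)\in\mathfrak{D}_\rho, \] with $\sigma_0(\rho)=\frac1{m_1(\rho)}$ and $\sigma_1(\rho)=\frac1{m_1(\rho)}-\frac{m_2(\rho)}{m_1(\rho)^3}=-\frac{\mathrm{Var}(\rho)}{m_1(\rho)^3}$.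
   Context: $i\mathbb{C}^+=\{iz:\operatorname{Im}z>0\}$. For a probability measure $\rho\neq\delta_0$ on $\mathbb{R}_+$: $\Psi_\rho(z)=\int\frac{xz}{1-xz}\rho(dx)$ is univalent on $i\mathbb{C}^+$; $\mathfrak{D}_\rho:=\Psi_\rho(i\mathbb{C}^+)$ and $\Psi_\rho^{-1}:\mathfrak{D}_\rho\to i\mathbb{C}^+$ is its inverse. The $S$-transform is $S_\rho(z)=\frac{(z+1)\Psi_\rho^{-1}(z)}{z}$ for $z\in\mathfrak{D}_\rho$, and the $\Sigma$-transform is $\Sigma_\rho(z)=S_\rho\!\left(\frac{z}{1-z}\right)$ whenever $\frac{z}{1-z}\in\mathfrak{D}_\rho$. *)

(* Defs.v *)
From HB Require Import structures.
From mathcomp Require Import all_boot all_order all_algebra.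
From mathcomp Require Import all_classical all_reals all_analysis.
From mathcomp Require Import complex.
Set Implicit Arguments. Unset Strict Implicit. Unset Printing Implicit Defensive.
Import Order.TTheory GRing.Theory Num.Theory.
Local Open Scope classical_set_scope.
Local Open Scope complex_scope.
Local Open Scope ring_scope.

Section Defs.
Variable R : realType.
Local Notation C := (R[i]).

Definition iCplus : set C := [set w | exists z : C, complex.Im z > 0 /\ w = 'i%C * z].

Definition mom (rho : probability R R) (k : nat) : R :=
  fine (\int[rho]_(x in `[0%R, +oo[%classic) (x ^+ k)%:E)%E.

Definition Psi_integrand (z : C) (x : R) : C :=
  (x%:C * z) / (1 - x%:C * z).

Definition Psi (rho : probability R R) (z : C) : C :=
  Complex (Rintegral rho `[0%R, +oo[ (fun x => complex.Re (Psi_integrand z x)))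
          (Rintegral rho `[0%R, +oo[ (fun x => complex.Im (Psi_integrand z x))).

Definition Dom (rho : probability R R) : set C := Psi rho @` iCplus.

(* inverse of Psi_rho on D_rho (Psi_rho is univalent on iC^+):
   the element w of iC^+ with Psi_rho w = z (default 0 outside D_rho) *)
Definition Psi_inv (rho : probability R R) (z : C) : C :=
  xget 0 [set w | iCplus w /\ Psi rho w = z].

Definition S_transform (rho : probability R R) (z : C) : C :=
  (z + 1) * Psi_inv rho z / z.

Definition Sigma_transform (rho : probability R R) (z : C) : C :=
  S_transform rho (z / (1 - z)).

Definition cnorm (z : C) : R := Normc.normc z.

Definition Var_rho (rho : probability R R) : R :=
  mom rho 2 - mom rho 1 ^+ 2.

End Defs.

(* Main.v *)
Require Import Defs.
From HB Require Import structures.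
From mathcomp Require Import all_boot all_order all_algebra.
From mathcomp Require Import all_classical all_reals all_analysis.
From mathcomp Require Import complex.
From mathcomp Require Import measurable_realfun ring lra.
Import Order.TTheory GRing.Theory Num.Theory.
Import numFieldNormedType.Exports.
Local Open Scope classical_set_scope.
Local Open Scope complex_scope.
Local Open Scope ring_scope.

(** For [w] in the left half-plane, [Psi w] agrees with [m_1 w + ... + m_p w^p]
    up to [o(w^p)], the Taylor remainder being dominated by
    [|w|^p x^p min(1, x|w|)]. Moreover [- Re (Psi w)] is at least the integral of
    [(x|w| / (1 + x|w|))^2], which increases with [|w|] and is positive because
    [rho] is not the Dirac mass at 0; hence [Psi w -> 0] forces [w -> 0].
    Composing with a polynomial that inverts [m_1 X + ... + m_p X^p] modulo
    [X^(p+1)] expands [Psi_inv], and then [S] and [Sigma]. Univalence of [Psi]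
    is never used: any preimage in the left half-plane will do. *)

(** * Compositional inverses of polynomials modulo a power of X *)

(** Induction on the precision: each round solves for one more coefficient of the inverse, by
    dividing by a power of the constant coefficient of [Q]. The two lowest coefficients of [U] are
    settled in the base case; they determine s_0 and s_1. *)
Lemma poly_inverse_mod (F : fieldType) (Q : {poly F}) (n : nat) : Q`_0 != 0 ->
  exists U r : {poly F}, [/\ U`_0 = (Q`_0)^-1, U`_1 = - Q`_1 / (Q`_0) ^+ 3 &
    ('X * U) \Po ('X * Q) = 'X + 'X^(n.+3) * r].
Proof.
move=> Q0; elim: n => [|n [U [r [U0 U1 UQ]]]].
  (* These values cancel the coefficients of degree 0 and 1 in [A], and the composite is
     ['X + 'X * A]. *)
  pose c0 := (Q`_0)^-1; pose c1 := - Q`_1 / (Q`_0) ^+ 3.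
  pose A := c0%:P * Q + c1%:P * ('X * Q ^+ 2) - 1.
  exists (c0%:P + c1%:P * 'X), (drop_poly 2 A); split.
  - by rewrite coefD coefC coefCM coefX mulr0 addr0.
  - by rewrite coefD coefC coefCM coefX mulr1 add0r.
  have A0 : A`_0 = 0.
    by rewrite !coefB coefD !coefCM coefXM coef1 mulr0 addr0 mulVf // subrr.
  have A1 : A`_1 = 0.
    rewrite !coefB coefD !coefCM coefXM coef1 /= expr2 coef0M subr0 /c0 /c1.
    by field.
  have -> : ('X * (c0%:P + c1%:P * 'X)) \Po ('X * Q) = 'X + 'X * A.
    rewrite comp_polyM comp_polyD comp_polyM !comp_polyC !comp_polyX /A; ring.
  rewrite -{1}[A](poly_take_drop 2) (_ : take_poly 2 A = 0).
    by rewrite add0r exprS mulrA [LHS]addrC; ring.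
  apply/polyP => -[|[|i]]; by rewrite coef_take_poly coef0.
(* Subtracting k X^(n+2) from [U] subtracts k X^(n+3) Q^(n+3) from the composite; this [k] cancels
   the constant coefficient of the error [r]. Since n+2 is at least 2, the two lowest coefficients
   of [U] do not change. *)
pose k := r`_0 / (Q`_0) ^+ n.+3.
pose s := r - k%:P * Q ^+ n.+3.
exists (U - k%:P * 'X^(n.+2)), (drop_poly 1 s); split.
- by rewrite coefB coefCM coefXn mulr0 subr0.
- by rewrite coefB coefCM coefXn mulr0 subr0.
rewrite mulrBr comp_polyB UQ.
have -> : 'X^(n.+4) * drop_poly 1 s = 'X^(n.+3) * s.
  rewrite -{2}[s](poly_take_drop 1) (_ : take_poly 1 s = 0).
    by rewrite add0r [in LHS]exprS; ring.
  apply/polyP => -[|i]; rewrite coef_take_poly coef0 //=.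
  rewrite coefB coefCM -!horner_coef0 horner_exp /k -!horner_coef0 divfK ?subrr //.
  by rewrite expf_eq0 /= horner_coef0.
rewrite mulrCA -exprS comp_polyM comp_polyC rmorphXn /= comp_polyX exprMn /s; ring.
Qed.

(** * The complex modulus, and polynomial bounds on discs *)

Section cnorm.
Variable R : realType.
Implicit Types z w : R[i].

Lemma cnorm_ge0 z : 0 <= cnorm z.
Proof. by case: z => a b; rewrite /cnorm /= sqrtr_ge0. Qed.

Lemma cnorm0 : cnorm (0 : R[i]) = 0. Proof. exact: Normc.normc0. Qed.
Lemma cnorm1 : cnorm (1 : R[i]) = 1. Proof. exact: Normc.normc1. Qed.
Lemma cnormM z w : cnorm (z * w) = cnorm z * cnorm w.
Proof. exact: Normc.normcM. Qed.
Lemma cnormV z : cnorm z^-1 = (cnorm z)^-1.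
Proof. exact: Normc.normcV. Qed.
Lemma cnormN z : cnorm (- z) = cnorm z.
Proof. exact: normcN. Qed.
Lemma cnormD z w : cnorm (z + w) <= cnorm z + cnorm w.
Proof. exact: le_normcD. Qed.
Lemma cnormX z n : cnorm (z ^+ n) = cnorm z ^+ n.
Proof. by elim: n => [|n IH]; rewrite ?expr0 ?cnorm1// !exprS cnormM IH. Qed.
Lemma cnorm_eq0 z : (cnorm z == 0) = (z == 0).
Proof. by apply/eqP/eqP => [/Normc.eq0_normc|->] //; exact: cnorm0. Qed.
Lemma cnorm_gt0 z : (0 < cnorm z) = (z != 0).
Proof. by rewrite lt_def cnorm_ge0 andbT cnorm_eq0. Qed.
Lemma cnormB z w : cnorm (z - w) <= cnorm z + cnorm w.
Proof. by rewrite -[cnorm w]cnormN cnormD. Qed.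
Lemma cnorm_ler_dist z w : cnorm z - cnorm w <= cnorm (z - w).
Proof. by rewrite lerBlDr -{1}[z](subrK w) cnormD. Qed.
Lemma cnorm_real (x : R) : cnorm x%:C = `|x|.
Proof. by rewrite /cnorm /= expr0n /= addr0 sqrtr_sqr. Qed.
Lemma sqr_cnorm z : cnorm z ^+ 2 = complex.Re z ^+ 2 + complex.Im z ^+ 2.
Proof. by case: z => a b; rewrite /cnorm /= sqr_sqrtr // addr_ge0 // sqr_ge0. Qed.
Lemma Re_le_cnorm z : `|complex.Re z| <= cnorm z.
Proof.
by rewrite -ler_sqr ?nnegrE ?cnorm_ge0 // sqr_cnorm real_normK ?num_real // lerDl sqr_ge0.
Qed.
Lemma Im_le_cnorm z : `|complex.Im z| <= cnorm z.
Proof.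
by rewrite -ler_sqr ?nnegrE ?cnorm_ge0 // sqr_cnorm real_normK ?num_real // lerDr sqr_ge0.
Qed.
Lemma cnorm_le_ReIm z : cnorm z <= `|complex.Re z| + `|complex.Im z|.
Proof.
rewrite -ler_sqr ?nnegrE ?cnorm_ge0 ?addr_ge0 // sqr_cnorm sqrrD !real_normK ?num_real //.
have := mulr_ge0 (normr_ge0 (complex.Re z)) (normr_ge0 (complex.Im z)); lra.
Qed.

Lemma poly_bounded (T : {poly R[i]}) (r : R) : exists K, [/\ 0 <= K &
  forall z, cnorm z <= r -> cnorm T.[z] <= K].
Proof.
elim/poly_ind: T => [|T c [K [K0 TK]]].
  by exists 0; split => // z _; rewrite horner0 cnorm0.
exists (K * `|r| + cnorm c); split; first by rewrite addr_ge0 ?mulr_ge0 ?cnorm_ge0.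
move=> z zr; rewrite hornerMXaddC (le_trans (cnormD _ _)) // lerD2r cnormM.
rewrite ler_pM ?cnorm_ge0 //; first exact: TK.
by rewrite (le_trans zr) // ler_norm.
Qed.

Lemma poly_lipschitz (T : {poly R[i]}) (r : R) : exists K, [/\ 0 <= K &
  forall z w, cnorm z <= r -> cnorm w <= r ->
    cnorm (T.[z] - T.[w]) <= K * cnorm (z - w)].
Proof.
elim/poly_ind: T => [|T c [K [K0 TK]]].
  by exists 0; split => // z w _ _; rewrite !horner0 subrr cnorm0 mul0r.
have [B [B0 TB]] := poly_bounded T r.
exists (K * `|r| + B); split; first by rewrite addr_ge0 ?mulr_ge0.
move=> z w zr wr; rewrite !hornerMXaddC.
have -> : T.[z] * z + c - (T.[w] * w + c) = (T.[z] - T.[w]) * z + T.[w] * (z - w) by ring.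
rewrite (le_trans (cnormD _ _)) // [leRHS]mulrDl !cnormM lerD //; last first.
  by rewrite ler_wpM2r ?cnorm_ge0 // TB.
rewrite mulrAC ler_pM ?cnorm_ge0 ?TK //.
by rewrite (le_trans zr) // ler_norm.
Qed.

(** * Little-o relations at 0 along a set *)

(** The quantifiers are those of the conclusion of [theorem8]; the bound is multiplied out, so
    nothing is divided by |z|^n. *)
Definition littleo_pow (A : set R[i]) (f : R[i] -> R[i]) (n : nat) : Prop :=
  forall eps : R, 0 < eps -> exists delta : R, 0 < delta /\
    forall z, A z -> cnorm z < delta -> cnorm (f z) <= eps * cnorm z ^+ n.

Lemma littleo_powD (A : set R[i]) f g n : littleo_pow A f n -> littleo_pow A g n ->
  littleo_pow A (fun z => f z + g z) n.
Proof.
move=> fo go e e0; have e20 : 0 < e / 2 by lra.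
have [d1 [d10 h1]] := fo _ e20; have [d2 [d20 h2]] := go _ e20.
exists (Num.min d1 d2); rewrite lt_min d10 d20; split=> // z Az.
rewrite lt_min => /andP[zd1 zd2]; rewrite (le_trans (cnormD _ _)) //.
by have := h1 z Az zd1; have := h2 z Az zd2; lra.
Qed.

(* Composition with [h] = O(z) and multiplication by a bounded factor at once. *)
Lemma littleo_pow_le (A B : set R[i]) (f g h : R[i] -> R[i]) (K r : R) (m n : nat) :
  0 <= K -> 0 < r -> littleo_pow A f n ->
  (forall z, B z -> cnorm z < r -> [/\ A (h z), cnorm (h z) <= K * cnorm z &
     cnorm (g z) * cnorm z ^+ m <= K * cnorm (f (h z))]) ->
  (forall z, B z -> z != 0) ->
  (m <= n)%N ->
  littleo_pow B g (n - m).
Proof.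
move=> K0 r0 fo hB B0 mn e e0.
pose K1 := K + 1; have K10 : 0 < K1 by rewrite /K1; lra.
(* One factor [K1] pays for the bound on [g], the power [K1 ^+ n] for |h z|^n <= (K1 |z|)^n. *)
have e'0 : 0 < e / (K1 * K1 ^+ n) by rewrite divr_gt0 ?mulr_gt0 ?exprn_gt0.
have [d [d0 hd]] := fo _ e'0.
exists (Num.min r (d / K1)); rewrite lt_min r0 divr_gt0 //; split=> // z Bz.
rewrite lt_min => /andP[zr zd]; have [Ah hK gK] := hB z Bz zr.
have z0 : 0 < cnorm z by rewrite cnorm_gt0 B0.
(* Both sides are multiplied by |z|^m, which is positive, so that the hypothesis on [g] applies and
   the full order n reappears on the right. *)
rewrite -(ler_pM2r (exprn_gt0 m z0)) -mulrA -exprD subnK // (le_trans gK) //.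
have hK1 : cnorm (h z) <= K1 * cnorm z by rewrite (le_trans hK) // ler_wpM2r ?cnorm_ge0 /K1; lra.
have hzd : cnorm (h z) < d by rewrite (le_lt_trans hK1) // mulrC -ltr_pdivlMr.
have hf := hd _ Ah hzd.
have : cnorm (f (h z)) <= e / K1 * cnorm z ^+ n.
  apply: (le_trans hf).
  apply: (@le_trans _ _ (e / (K1 * K1 ^+ n) * (K1 * cnorm z) ^+ n)).
    by rewrite ler_pM2l // lerXn2r ?nnegrE ?mulr_ge0 ?cnorm_ge0 // ltW.
  rewrite exprMn le_eqVlt; apply/orP; left; apply/eqP.
  by field; rewrite ?expf_neq0 gt_eqF.
move=> hf2; apply: (@le_trans _ _ (K1 * (e / K1 * cnorm z ^+ n))).
  by rewrite ler_pM ?cnorm_ge0 // /K1; lra.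
by rewrite mulrA [K1 * _]mulrC divfK ?gt_eqF.
Qed.

Lemma littleo_pow_poly (A : set R[i]) (r : {poly R[i]}) (n : nat) :
  littleo_pow A (fun z => z ^+ n.+1 * r.[z]) n.
Proof.
have [K [K0 hK]] := poly_bounded r 1.
move=> e e0; exists (Num.min 1 (e / (K + 1))).
have K1 : 0 < K + 1 by lra.
rewrite lt_min ltr01 divr_gt0 //; split=> // z _; rewrite lt_min => /andP[z1 zd].
rewrite cnormM cnormX exprS mulrAC ler_wpM2r ?exprn_ge0 ?cnorm_ge0 //.
have := hK z (ltW z1); rewrite ltr_pdivlMr // in zd => ?.
apply: (@le_trans _ _ (cnorm z * (K + 1))); last exact: ltW.
by rewrite ler_wpM2l ?cnorm_ge0 //; lra.
Qed.

End cnorm.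

(** * The integrand of [Psi] on the left half-plane *)

Lemma measurable_fun_inv_gt0 (R : realType) d (T : measurableType d) (D : set T) (f : T -> R) :
  (forall x, D x -> 0 < f x) -> measurable_fun D f ->
  measurable_fun D (fun x => (f x)^-1).
Proof.
move=> f0 mf.
have -> : (fun x => (f x)^-1) = GRing.inv \o f by [].
refine (measurable_comp (F := `]0, +oo[%classic) (T2 := R) _ _ _ mf); first exact: measurable_itv.
- by move=> _ [x Dx <-] /=; rewrite in_itv /= f0.
- apply: open_continuous_measurable_fun => // x.
  by rewrite inE /= in_itv /= andbT => x0; apply: inv_continuous; rewrite gt_eqF.
Qed.

(** The right-hand side is |1 - xz|^2, and its real part 1 - x Re z is already at least 1. *)
Lemma Psi_den_ge1 (R : realType) (z : R[i]) (x : R) :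
  complex.Re z < 0 -> 0 <= x ->
  1 <= (1 - x * complex.Re z) ^+ 2 + (x * complex.Im z) ^+ 2.
Proof. by case: z => a b /= a0 x0; have := sqr_ge0 (x * b); nra. Qed.

Lemma Psi_integrandE (R : realType) (z : R[i]) (x : R) :
  let a := complex.Re z in let b := complex.Im z in
  Psi_integrand z x =
  Complex ((x * a - x ^+ 2 * (a ^+ 2 + b ^+ 2)) / ((1 - x * a) ^+ 2 + (x * b) ^+ 2))
          (x * b / ((1 - x * a) ^+ 2 + (x * b) ^+ 2)).
Proof.
case: z => a b /=; rewrite /Psi_integrand.
simpc; rewrite sqrrN.
set k := (_ + _)^-1; congr Complex; ring.
Qed.

Lemma sub1_neq0 (R : realType) (z : R[i]) (x : R) :
  complex.Re z < 0 -> 0 <= x -> 1 - x%:C * z != 0.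
Proof.
case: z => a b /= a0 x0; apply/eqP => /(congr1 (@complex.Re R)) /=.
rewrite mul0r; nra.
Qed.

(** One step of the geometric series; iterating it produces the Taylor expansion with an exact
    remainder. *)
Lemma Psi_integrand_geom (R : realType) (z : R[i]) (x : R) :
  complex.Re z < 0 -> 0 <= x ->
  Psi_integrand z x = x%:C * z + x%:C * z * Psi_integrand z x.
Proof.
move=> z0 x0; have := @sub1_neq0 _ z x z0 x0; rewrite /Psi_integrand => h.
by field.
Qed.

(** Since |1 - xz|^2 = 1 - 2x Re z + |xz|^2, the denominator dominates both |xz| and 1, which gives
    the two bounds. *)
Lemma cnorm_Psi_integrand (R : realType) (z : R[i]) (x : R) :
  complex.Re z < 0 -> 0 <= x ->
  cnorm (Psi_integrand z x) <= Num.min 1 (x * cnorm z).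
Proof.
move=> z0 x0; have h := @sub1_neq0 _ z x z0 x0.
have hp : 0 < cnorm (1 - x%:C * z) by rewrite cnorm_gt0.
have sq : cnorm (1 - x%:C * z) ^+ 2 = (1 - x * complex.Re z) ^+ 2 + (x * complex.Im z) ^+ 2.
  by rewrite sqr_cnorm; case: (z) => a b /=; rewrite !mul0r !subr0 ?addr0 sub0r sqrrN.
rewrite /Psi_integrand cnormM cnormV le_min; apply/andP; split.
  rewrite ler_pdivrMr // mul1r -ler_sqr ?nnegrE ?cnorm_ge0 // sq sqr_cnorm.
  by case: (z) z0 => a b /= a0; rewrite !mul0r subr0 ?addr0; nra.
rewrite ler_pdivrMr // cnormM cnorm_real ger0_norm // ler_peMr ?mulr_ge0 ?cnorm_ge0 //.
rewrite -(@ler_sqr _ 1) ?nnegrE ?cnorm_ge0 // sq expr1n.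
exact: Psi_den_ge1.
Qed.

Lemma Re_Psi_integrand_le (R : realType) (z : R[i]) (x d : R) :
  complex.Re z < 0 -> 0 <= x -> 0 <= d <= cnorm z ->
  (x * d / (1 + x * d)) ^+ 2 <= - complex.Re (Psi_integrand z x).
Proof.
Proof.
move=> z0 x0 /andP[d0 dz]; rewrite Psi_integrandE /=.
have := sqr_cnorm _ z; have := Psi_den_ge1 _ z x z0 x0.
set q := (X in 1 <= X) => q1 sz.
set a := complex.Re z in z0 q q1 sz *; set b := complex.Im z in q q1 sz *.
have s0 := cnorm_ge0 _ z; set s := cnorm z in dz sz s0 *.
(* As t/(1+t) increases with t, [d] may be replaced by |z|. *)
apply: (@le_trans _ _ ((x * s / (1 + x * s)) ^+ 2)).
  rewrite lerXn2r ?nnegrE ?divr_ge0 ?addr_ge0 ?mulr_ge0 //.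
  rewrite ler_pdivrMr; last by nra.
  rewrite mulrAC ler_pdivlMr; last by nra.
  have : x * d <= x * s by rewrite ler_wpM2l.
  by nra.
have q0 : 0 < q by lra.
rewrite -mulNr expr_div_n ler_pdivrMr; last by rewrite exprn_gt0 //; nra.
rewrite mulrAC ler_pdivlMr // /q -sz.
have as_ : - a <= s by have := Re_le_cnorm _ z; rewrite -/a -/s ler_norml; lra.
have -> : (1 - x * a) ^+ 2 + (x * b) ^+ 2 = 1 + 2 * (- (x * a)) + (x * s) ^+ 2.
  by rewrite [(x * s) ^+ 2]exprMn sz; ring.
have -> : - (x * a - x ^+ 2 * s ^+ 2) = - (x * a) + (x * s) ^+ 2 by ring.
have : 0 <= - (x * a) by nra.
have : - (x * a) <= x * s by rewrite -mulrN ler_wpM2l.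
have : 0 <= x * s by nra.
(* It remains to see t^2 (1 + 2c + t^2) <= (c + t^2)(1 + t)^2. The difference is c + 2tc + t^2 (t -
   c) + t^3, a sum of nonnegative terms because 0 <= c <= t. *)
set c := - (x * a); set t := x * s => t0 ct c0.
have : 0 <= t ^+ 2 * (t - c) by rewrite mulr_ge0 ?sqr_ge0 // subr_ge0.
have : 0 <= t * c by rewrite mulr_ge0.
have : 0 <= t ^+ 2 * t by rewrite mulr_ge0 ?sqr_ge0.
lra.
Qed.

(** * Integrals against rho: positivity, Taylor expansion, tails *)

Section moments.
Variables (R : realType) (rho : probability R R).
Let D : set R := `[0, +oo[%classic.
Let mD : measurable D. Proof. exact: measurable_itv. Qed.

(** A zero integral makes [f] vanish almost everywhere, hence the positive half-line is null; the
    negative one is null too, so rho would be the Dirac mass at 0. *)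
Lemma Rintegral_gt0_ndirac (f : R -> R) :
  rho [set x : R | x < 0] = 0%E ->
  ~ (forall A : set R, measurable A -> rho A = @dirac _ R (0 : R) R A) ->
  rho.-integrable D (EFin \o f) -> (forall x, 0 <= x -> 0 <= f x) ->
  (forall x, 0 < x -> 0 < f x) -> 0 < Rintegral rho D f.
Proof.
move=> supp ndirac intf f0 fgt0.
have D0 x : D x -> 0 <= x by rewrite /D /= in_itv /= andbT.
have mf := measurable_int _ intf.
rewrite lt_def Rintegral_ge0 ?andbT; last by move=> x /D0 /f0.
apply/eqP => I0; apply: ndirac.
have : (\int[rho]_(x in D) `|(EFin \o f) x| = 0)%E.
  rewrite -[RHS]/((0:R)%:E) -I0 /Rintegral fineK ?integrable_fin_num //.
  by apply: eq_integral => x; rewrite inE => /D0 x0; rewrite gee0_abs // lee_fin f0.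
move/(ae_eq_integral_abs rho mD mf) => [N [mN N0 subN]].
have pos0 : rho [set x | 0 < x] = 0%E.
  apply/eqP; rewrite -measure_le0 -N0; apply: le_measure; rewrite ?inE //.
    by have := @measurable_itv R `]0, +oo[; rewrite set_itvoy.
  move=> x /= x0; apply: subN => /= fx0; have := fgt0 _ x0.
  have /fx0 [->] : D x by rewrite /D /= in_itv /= ltW.
  by rewrite ltxx.
have mn : measurable [set x : R | x < 0].
  by have := @measurable_itv R `]-oo, 0[; rewrite set_itvNyo.
have mp : measurable [set x : R | 0 < x].
  by have := @measurable_itv R `]0, +oo[; rewrite set_itvoy.
have n0 : rho (~` [set 0]) = 0%E.
  have -> : ~` [set (0:R)] = [set x | x < 0] `|` [set x | 0 < x].
    apply/seteqP; split => x /=; first by move/eqP; rewrite neq_lt => /orP.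
    by move=> h; apply/eqP; rewrite neq_lt; apply/orP.
  by rewrite null_set_setU.
have r1 : rho [set 0] = 1%E.
  rewrite -[X in rho X]setCK probability_setC; last exact: measurableC.
  by rewrite [X in (_ - X)%E]n0 sube0.
move=> A mA; rewrite diracE.
(* Sets avoiding 0 are null; a set containing 0 is then handled through its complement. *)
have z0 (B : set R) : measurable B -> ~ B 0 -> rho B = 0%E.
  move=> mB B0; apply/eqP; rewrite -measure_le0 -n0.
  apply: le_measure; rewrite ?inE //; first exact: measurableC.
  by move=> x Bx /= x0; apply: B0; rewrite -x0.
have [A0|A0] := pselect (A 0).
  rewrite mem_set //= -(setCK A) probability_setC ?z0 ?sube0 //; first exact: measurableC.
  exact: measurableC.
by rewrite memNset //= z0.
Qed.


Lemma integrable_exprn (p : nat) :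
  (\int[rho]_(x in D) (x ^+ p)%:E < +oo)%E ->
  rho.-integrable D (EFin \o (fun x => x ^+ p)).
Proof.
move=> hp; apply/integrableP; split.
  by apply/measurable_EFinP; exact: exprn_measurable.
rewrite (_ : integral _ _ _ = \int[rho]_(x in D) (x ^+ p)%:E)%E //.
apply: eq_integral => x; rewrite inE /D /= in_itv /= andbT => x0.
by rewrite ger0_norm // exprn_ge0.
Qed.

Lemma measurable_Psi_integrand (z : R[i]) : complex.Re z < 0 ->
  measurable_fun D (fun x => complex.Re (Psi_integrand z x)) /\
  measurable_fun D (fun x => complex.Im (Psi_integrand z x)).
Proof.
move=> z0; split; under eq_fun do rewrite Psi_integrandE /=.
- apply: measurable_funM.
    apply: measurable_funB; first exact: measurable_funM.
    by apply: measurable_funM => //; exact: measurable_funX.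
  apply: measurable_fun_inv_gt0.
    move=> x; rewrite /D /= in_itv /= andbT => x0.
    by rewrite (lt_le_trans ltr01) // Psi_den_ge1.
  apply: measurable_funD; apply: measurable_funX; last exact: measurable_funM.
  by apply: measurable_funB => //; exact: measurable_funM.
- apply: measurable_funM; first exact: measurable_funM.
  apply: measurable_fun_inv_gt0.
    move=> x; rewrite /D /= in_itv /= andbT => x0.
    by rewrite (lt_le_trans ltr01) // Psi_den_ge1.
  apply: measurable_funD; apply: measurable_funX; last exact: measurable_funM.
  by apply: measurable_funB => //; exact: measurable_funM.
Qed.

Section projection.
(** [phi] stands for the real or the imaginary part, so that both components of [Psi] are treated by
    one argument. *)
Variable phi : R[i] -> R.
Hypothesis phiD : forall z w, phi (z + w) = phi z + phi w.
Hypothesis phiZ : forall x z, phi (x%:C * z) = x * phi z.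
Hypothesis phi_le : forall z, `|phi z| <= cnorm z.

(** Used for measurability: the dependence on x is confined to x^n and to the two components of the
    integrand, while the values of [phi] become constants. *)
Lemma phi_powerM (z : R[i]) (x : R) (n : nat) :
  phi ((x%:C * z) ^+ n * Psi_integrand z x) =
  x ^+ n * (complex.Re (Psi_integrand z x) * phi (z ^+ n) +
            complex.Im (Psi_integrand z x) * phi (z ^+ n * 'i)).
Proof.
rewrite exprMn -rmorphXn /= -mulrA phiZ; congr (_ * _).
case: (Psi_integrand z x) => g h /=; rewrite -!phiZ -phiD; congr phi.
rewrite [in LHS](_ : Complex g h = g%:C + h%:C * 'i); last by simpc.
ring.
Qed.

Lemma phi_power_le (z : R[i]) (x : R) (n : nat) : complex.Re z < 0 -> 0 <= x ->
  `|phi ((x%:C * z) ^+ n * Psi_integrand z x)| <=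
  cnorm z ^+ n * (x ^+ n * Num.min 1 (x * cnorm z)).
Proof.
move=> z0 x0; rewrite (le_trans (phi_le _)) // cnormM cnormX cnormM cnorm_real.
rewrite ger0_norm // exprMn -mulrA mulrCA.
apply: ler_wpM2l; first by rewrite exprn_ge0 ?cnorm_ge0.
by apply: ler_wpM2l; rewrite ?exprn_ge0 ?cnorm_Psi_integrand.
Qed.

Lemma integrable_phi_power (z : R[i]) (n : nat) : complex.Re z < 0 ->
  (\int[rho]_(x in D) (x ^+ n)%:E < +oo)%E ->
  rho.-integrable D (EFin \o (fun x => phi ((x%:C * z) ^+ n * Psi_integrand z x))).
Proof.
move=> z0 hn; have [mRe mIm] := measurable_Psi_integrand z z0.
have hi := integrable_exprn _ hn.
have := integrableZl mD (cnorm z ^+ n) hi; apply: le_integrable => //.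
  apply/measurable_EFinP; under eq_fun do rewrite phi_powerM.
  apply: measurable_funM; first exact: exprn_measurable.
  by apply: measurable_funD; apply: measurable_funM.
move=> x; rewrite /D /= in_itv /= andbT => x0; rewrite lee_fin.
rewrite (le_trans (phi_power_le _ _ _ z0 x0)) // ger0_norm; last first.
  by rewrite mulr_ge0 ?exprn_ge0 ?cnorm_ge0.
rewrite ler_wpM2l ?exprn_ge0 ?cnorm_ge0 // ler_piMr ?exprn_ge0 //.
by rewrite ge_min lexx.
Qed.

(** Induction on n: one geometric step inside the remainder splits off x^(n+1) phi(z^(n+1)), whose
    integral is the next term of the sum. *)
Lemma phi_Psi_expansion (z : R[i]) (n : nat) : complex.Re z < 0 ->
  (forall k, (k <= n)%N -> (\int[rho]_(x in D) (x ^+ k)%:E < +oo)%E) ->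
  Rintegral rho D (fun x => phi (Psi_integrand z x)) =
  \sum_(k < n) mom rho k.+1 * phi (z ^+ k.+1) +
  Rintegral rho D (fun x => phi ((x%:C * z) ^+ n * Psi_integrand z x)).
Proof.
move=> z0; elim: n => [|n IH] hn.
  rewrite big_ord0 add0r; congr Rintegral.
  by apply/funext => x; rewrite expr0 mul1r.
rewrite IH => [|k kn]; last by rewrite hn // (leq_trans kn).
rewrite big_ord_recr /= -addrA; congr (_ + _).
have hi := integrable_exprn _ (hn _ (leqnn _)).
have -> : mom rho n.+1 * phi (z ^+ n.+1) =
    Rintegral rho D (fun x => x ^+ n.+1 * phi (z ^+ n.+1)).
  by rewrite RintegralZr //; exact: hi.
rewrite -RintegralD //; last by apply: integrable_phi_power => //; exact: hn.
  apply: eq_Rintegral => x; rewrite inE /D /= in_itv /= andbT => x0.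
  rewrite [in LHS]Psi_integrand_geom // mulrDr phiD; congr (_ + _).
    by rewrite -exprSr exprMn -rmorphXn /= phiZ.
  by rewrite mulrA -exprSr.
under eq_fun do rewrite mulrC.
exact: (integrableZl mD (phi (z ^+ n.+1)) hi).
Qed.

End projection.

(* The factor of [|z|^p] in the bound on the Taylor remainder. *)
Definition tail_moment (p : nat) (t : R) : R :=
  Rintegral rho D (fun x => x ^+ p * Num.min 1 (x * t)).

Lemma integrable_tail_moment (p : nat) (t : R) :
  0 <= t -> (\int[rho]_(x in D) (x ^+ p)%:E < +oo)%E ->
  rho.-integrable D (EFin \o (fun x => x ^+ p * Num.min 1 (x * t))).
Proof.
move=> t0 /integrable_exprn; apply: le_integrable => //.
  apply/measurable_EFinP; apply: measurable_funM; first exact: exprn_measurable.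
  by apply: measurable_minr => //; exact: measurable_funM.
move=> x; rewrite /D /= in_itv /= andbT => x0; rewrite lee_fin.
rewrite normrM ler_piMr ?normr_ge0 // ger0_norm ?ge_min ?lexx //.
by rewrite le_min ler01 mulr_ge0.
Qed.

Lemma tail_moment_le (p : nat) (s t : R) :
  0 <= s <= t -> (\int[rho]_(x in D) (x ^+ p)%:E < +oo)%E ->
  tail_moment p s <= tail_moment p t.
Proof.
move=> /andP[s0 st] hp; have t0 := le_trans s0 st.
apply: le_Rintegral => //; try exact: integrable_tail_moment.
move=> x; rewrite /D /= in_itv /= andbT => x0.
rewrite ler_wpM2l ?exprn_ge0 // le_min ge_min lexx /= ge_min ler_wpM2l // orbT //.
Qed.

(** Dominated convergence along t = 1/(n+1), with majorant x^p and pointwise bound x^(p+1)/(n+1). A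
    single t suffices, since [tail_moment] is monotone in t. *)
Lemma tail_moment_cvg0 (p : nat) (e : R) : 0 < e ->
  (\int[rho]_(x in D) (x ^+ p)%:E < +oo)%E ->
  exists2 t, 0 < t & tail_moment p t <= e.
Proof.
move=> e0 hp; have ip := integrable_exprn _ hp.
pose f (n : nat) (x : R) := x ^+ p * Num.min 1 (x * harmonic n).
have : (\int[rho]_(x in D) (f n x)%:E @[n --> \oo] --> \int[rho]_(x in D) (0 : R)%:E)%E.
  apply: (@dominated_cvg _ _ _ rho D mD (fun n x => (f n x)%:E) (fun=> 0%:E)
    (fun x => (x ^+ p)%:E)) => //.
  - move=> n; exact: measurable_int (integrable_tail_moment p (harmonic n) (harmonic_ge0 n) hp).
  - move=> x; rewrite /D /= in_itv /= andbT => x0.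
    apply/cvg_EFin; first exact: nearW.
    apply: (@squeeze_cvgr _ _ _ _ (fun=> 0) (fun n => x ^+ p.+1 * harmonic n)).
    + apply: nearW => n; rewrite /f mulr_ge0 ?exprn_ge0 ?le_min ?ler01 ?mulr_ge0 ?harmonic_ge0 //=.
      by rewrite exprSr -mulrA ler_wpM2l ?exprn_ge0 // ge_min lexx orbT.
    + exact: cvg_cst.
    + rewrite -[X in _ --> X](mulr0 (x ^+ p.+1)); apply: cvgMr; exact: cvg_harmonic.
  - move=> n x; rewrite /D /= in_itv /= andbT => x0; rewrite lee_fin /f.
    rewrite ger0_norm ?mulr_ge0 ?exprn_ge0 ?le_min ?ler01 ?mulr_ge0 ?harmonic_ge0 //.
    by rewrite ler_piMr ?exprn_ge0 // ge_min lexx.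
rewrite integral0 => /fine_cvg /cvgrPdist_le /(_ _ e0) [N _ /(_ N (leqnn N))] /=.
rewrite sub0r normrN => hN; exists (harmonic N); first exact: harmonic_gt0.
exact: le_trans (ler_norm _) hN.
Qed.

End moments.

(** * Expansion of [Psi] and of its inverse at 0 *)

Lemma projection_sum (R : realType) (phi : R[i] -> R) (n : nat) (m : nat -> R) (u : nat -> R[i]) :
  (forall z w, phi (z + w) = phi z + phi w) ->
  (forall x z, phi (x%:C * z) = x * phi z) ->
  phi (\sum_(k < n) (m k)%:C * u k) = \sum_(k < n) m k * phi (u k).
Proof.
move=> phiD phiZ; elim: n => [|n IH]; last by rewrite !big_ord_recr /= phiD IH phiZ.
by rewrite !big_ord0 -[X in phi X](mul0r 0) -(rmorph0 (real_complex R)) phiZ mul0r.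
Qed.

Lemma complex_ReD (R : realType) (z w : R[i]) :
  complex.Re (z + w) = complex.Re z + complex.Re w.
Proof. by case: z; case: w. Qed.

Lemma complex_ImD (R : realType) (z w : R[i]) :
  complex.Im (z + w) = complex.Im z + complex.Im w.
Proof. by case: z; case: w. Qed.

Lemma complex_ReZ (R : realType) (x : R) (z : R[i]) :
  complex.Re (x%:C * z) = x * complex.Re z.
Proof. by case: z => a b /=; rewrite mul0r subr0. Qed.

Lemma complex_ImZ (R : realType) (x : R) (z : R[i]) :
  complex.Im (x%:C * z) = x * complex.Im z.
Proof. by case: z => a b /=; rewrite mul0r addr0. Qed.

Section Psi_asymptotics.
Variables (R : realType) (rho : probability R R) (p : nat).
Hypothesis hmom : forall k : nat, (k <= p)%N ->
  (\int[rho]_(x in `[0%R, +oo[%classic) (x ^+ k)%:E < +oo)%E.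

(** The index shift makes ['X * Q] the Taylor polynomial m_1 X + ... + m_p X^p, and m_1 the constant
    coefficient of [Q], as needed to invert it. *)
Definition moment_poly : {poly R[i]} := \poly_(k < p) (mom rho k.+1)%:C.

Let Q := moment_poly.

Lemma moment_polyE (z : R[i]) : ('X * Q).[z] = \sum_(k < p) (mom rho k.+1)%:C * z ^+ k.+1.
Proof.
rewrite hornerM hornerX horner_poly mulr_sumr; apply: eq_bigr => k _.
by rewrite exprS mulrCA.
Qed.

(** The factor 2 adds the bounds for the real and the imaginary part. *)
Lemma Psi_remainder_le (z : R[i]) : complex.Re z < 0 ->
  cnorm (Psi rho z - ('X * Q).[z]) <= 2 * (cnorm z ^+ p * tail_moment R rho p (cnorm z)).
Proof.
move=> z0; have pp := hmom p (leqnn p).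
have part (phi : R[i] -> R) : (forall z w, phi (z + w) = phi z + phi w) ->
    (forall x z, phi (x%:C * z) = x * phi z) -> (forall z, `|phi z| <= cnorm z) ->
    `|Rintegral rho `[0, +oo[%classic (fun x => phi (Psi_integrand z x)) - phi ('X * Q).[z]|
     <= cnorm z ^+ p * tail_moment R rho p (cnorm z).
  move=> phiD phiZ phi_le.
  rewrite (phi_Psi_expansion _ rho phi phiD phiZ phi_le _ p) // moment_polyE.
  rewrite (projection_sum R phi p (fun k => mom rho k.+1) (fun k => z ^+ k.+1)) // addrC addKr.
  have ii := integrable_phi_power R rho phi phiD phiZ phi_le z p z0 pp.
  have it := integrable_tail_moment R rho p _ (cnorm_ge0 _ z) pp.
  rewrite (le_trans (le_normr_Rintegral _ ii)) ?measurable_itv //.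
  rewrite /tail_moment -RintegralZl ?measurable_itv //.
  apply: le_Rintegral; rewrite ?measurable_itv //.
  - exact: integrable_norm ii.
  - exact: (integrableZl _ (cnorm z ^+ p) it).
  - by move=> x; rewrite /= in_itv /= andbT => x0; exact: phi_power_le.
have hRe := part _ (complex_ReD R) (complex_ReZ R) (Re_le_cnorm R).
have hIm := part _ (complex_ImD R) (complex_ImZ R) (Im_le_cnorm R).
rewrite (le_trans (cnorm_le_ReIm _ _)) //.
rewrite (_ : complex.Re (Psi rho z - ('X * Q).[z]) =
  Rintegral rho `[0, +oo[%classic (fun x => complex.Re (Psi_integrand z x)) - complex.Re ('X * Q).[z]);
  last by rewrite /Psi; case: (('X * Q).[z]).
rewrite (_ : complex.Im (Psi rho z - ('X * Q).[z]) =
  Rintegral rho `[0, +oo[%classic (fun x => complex.Im (Psi_integrand z x)) - complex.Im ('X * Q).[z]);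
  last by rewrite /Psi; case: (('X * Q).[z]).
lra.
Qed.

Lemma Psi_littleo :
  littleo_pow R [set z | complex.Re z < 0] (fun z => Psi rho z - ('X * Q).[z]) p.
Proof.
move=> e e0; have pp := hmom p (leqnn p).
have e20 : 0 < e / 2 by lra.
have [t t0 te] := tail_moment_cvg0 _ rho p _ e20 pp.
exists t; split=> // z z0 zt; rewrite (le_trans (Psi_remainder_le _ z0)) //.
have : tail_moment R rho p (cnorm z) <= e / 2.
  by rewrite (le_trans _ te) // tail_moment_le // cnorm_ge0 ltW.
move=> h; have := ler_wpM2r (exprn_ge0 p (cnorm_ge0 _ z)) h; lra.
Qed.

Hypothesis rho_supp : rho [set x : R | x < 0] = 0%E.
Hypothesis rho_ndirac :
  ~ (forall A : set R, measurable A -> rho A = @dirac _ R (0 : R) R A).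

Lemma mom1_gt0 : (0 < p)%N -> 0 < mom rho 1.
Proof.
move=> p0; apply: (@Rintegral_gt0_ndirac _ _ (fun x => x ^+ 1)) => //.
by apply: integrable_exprn; exact: hmom.
Qed.

(* This forces [Psi_inv z --> 0] as [z --> 0]. *)
Lemma cnorm_Psi_ge (d : R) : 0 < d -> exists2 c, 0 < c &
  forall z, complex.Re z < 0 -> d <= cnorm z -> c <= cnorm (Psi rho z).
Proof.
move=> d0.
have h0 := integrable_exprn _ _ _ (hmom 0 (leq0n p)).
(* A lower bound for minus the real part of the integrand, uniform over |z| >= d. It is at most 1,
   hence integrable, and [c] will be its integral. *)
pose f x : R := (x * d / (1 + x * d)) ^+ 2.
have fi : rho.-integrable `[0, +oo[%classic (EFin \o f).
  apply: (le_integrable _ _ _ h0); rewrite ?measurable_itv //.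
    apply/measurable_EFinP; apply: measurable_funX; apply: measurable_funM.
      exact: measurable_funM.
    apply: measurable_fun_inv_gt0; last by apply: measurable_funD => //; exact: measurable_funM.
    by move=> x; rewrite /= in_itv /= andbT => x0; rewrite ltr_wpDr // mulr_ge0 // ltW.
  move=> x; rewrite /= in_itv /= andbT => x0; rewrite lee_fin expr0 normr1 /f.
  have xd : 0 <= x * d by rewrite mulr_ge0 // ltW.
  rewrite ger0_norm ?sqr_ge0 // expr_le1 ?divr_ge0 ?addr_ge0 //.
  by rewrite ler_pdivrMr; lra.
exists (Rintegral rho `[0, +oo[%classic f).
  apply: Rintegral_gt0_ndirac => //; first by move=> x x0; exact: sqr_ge0.
  by move=> x x0; rewrite exprn_gt0 // divr_gt0 ?addr_gt0 ?mulr_gt0.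
move=> z z0 dz.
have iRe : rho.-integrable `[0, +oo[%classic (EFin \o (fun x => complex.Re (Psi_integrand z x))).
  have := integrable_phi_power R rho _ (complex_ReD R) (complex_ReZ R) (Re_le_cnorm R) z 0 z0 (hmom 0 (leq0n p)).
  congr (rho.-integrable _ _); apply/funext => x /=; rewrite expr0 mul1r //.
apply: (@le_trans _ _ (- complex.Re (Psi rho z))); last first.
  by rewrite (le_trans _ (Re_le_cnorm _ _)) // -normrN ler_norm.
rewrite /Psi /= -mulN1r -RintegralZl ?measurable_itv //.
apply: le_Rintegral; rewrite ?measurable_itv //.
  exact: (integrableZl _ (-1) iRe).
move=> x; rewrite /= in_itv /= andbT => x0; rewrite mulN1r.
by apply: Re_Psi_integrand_le => //; rewrite ltW.
Qed.

(** A point i(a + ib) with b > 0 has real part -b, so the chosen preimage lies in the left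
    half-plane. *)
Lemma Psi_invP (z : R[i]) : Dom rho z ->
  complex.Re (Psi_inv rho z) < 0 /\ Psi rho (Psi_inv rho z) = z.
Proof.
case=> w iw wz; have : exists w, iCplus w /\ Psi rho w = z by exists w.
move=> /(xgetPex 0); rewrite -/(Psi_inv rho z) => -[[[a b] [/= b0 ->]] hz].
by split=> //=; rewrite mul0r mul1r sub0r oppr_lt0.
Qed.

(** The lower bound on |Psi w| is applied with d = |w|. *)
Lemma Dom_neq0 (z : R[i]) : Dom rho z -> z != 0.
Proof.
move=> /Psi_invP [w0 <-]; set w := Psi_inv rho z in w0 *.
have wn : w != 0 by apply/eqP => we; move: w0; rewrite we ltxx.
have wp : 0 < cnorm w by rewrite cnorm_gt0.
have [c c0 hc] := cnorm_Psi_ge _ wp.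
by rewrite -cnorm_gt0 (lt_le_trans c0) // hc.
Qed.

(** With w the preimage of z, m_1 w equals z up to the Taylor remainder and the terms of degree at
    least 2. Each costs at most (m_1/4)|w| for small w, which leaves (m_1/2)|w| <= |z|. *)
Lemma Psi_inv_linear_bound : (0 < p)%N -> exists K r : R, [/\ 0 <= K, 0 < r &
  forall z, Dom rho z -> cnorm z < r ->
    cnorm (Psi_inv rho z) <= 1 /\ cnorm (Psi_inv rho z) <= K * cnorm z].
Proof.
move=> p0; have m0 := mom1_gt0 p0; set m := mom rho 1 in m0.
have m40 : 0 < m / 4 by lra.
have [d1 [d10 h1]] := Psi_littleo _ m40.
have [L [L0 hL]] := poly_lipschitz _ Q 1.
(* The three bounds serve the Taylor remainder, |w|^p <= |w|, and L|w| <= m/4; [L + 1] keeps the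
   divisor positive. *)
pose d := Num.min d1 (Num.min 1 (m / (4 * (L + 1)))).
have dp : 0 < d by rewrite !lt_min d10 ltr01 divr_gt0 //; lra.
have [c c0 hc] := cnorm_Psi_ge _ dp.
exists (2 / m), c; split; [by rewrite divr_ge0 // ltW| by []|].
move=> z Dz zc; have [w0 wz] := Psi_invP _ Dz; set w := Psi_inv rho z in w0 wz *.
have : cnorm w < d.
  by rewrite ltNge; apply/negP => /(hc _ w0); rewrite wz leNgt zc.
rewrite !lt_min => /and3P[wd1 w1 wm]; split; first exact: ltW.
have := h1 w w0 wd1; rewrite wz => hz.
have wp : cnorm w ^+ p <= cnorm w.
  by rewrite -(prednK p0) exprS ler_piMr ?cnorm_ge0 // exprn_ile1 ?cnorm_ge0 // ltW.
have Q0 : Q.[0] = m%:C by rewrite horner_coef0 coef_poly p0.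
have hQ : cnorm (w * (Q.[w] - Q.[0])) <= cnorm w * (L * cnorm w).
  rewrite cnormM; apply: ler_wpM2l; first exact: cnorm_ge0.
  by have := hL w 0 (ltW w1); rewrite cnorm0 subr0; apply; exact: ler01.
have : cnorm (m%:C * w) <= cnorm z + cnorm (z - ('X * Q).[w]) + cnorm (w * (Q.[w] - Q.[0])).
  have -> : m%:C * w = z - (z - ('X * Q).[w]) - w * (Q.[w] - Q.[0]).
    by rewrite Q0 hornerM hornerX; ring.
  by rewrite (le_trans (cnormB _ _ _)) // lerD2r cnormB.
rewrite cnormM cnorm_real (gtr0_norm m0) => hm.
have hp4 : m / 4 * cnorm w ^+ p <= m / 4 * cnorm w by rewrite ler_wpM2l // ltW.
have hLw : L * cnorm w <= m / 4.
  rewrite ltr_pdivlMr in wm; last by lra.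
  by have := cnorm_ge0 _ w; nra.
have hwL : cnorm w * (L * cnorm w) <= cnorm w * (m / 4) by rewrite ler_wpM2l ?cnorm_ge0.
by rewrite mulrAC ler_pdivlMr //; lra.
Qed.

(** With w the preimage of z, w - T(z) splits at T(P(w)). The part w - T(P(w)) is -w^(p+1) r(w); the
    other is at most a constant times |P(w) - z|, the error of [Psi_littleo]. Both are o(w^p), hence
    o(z^p) by the linear bound. *)
Lemma Psi_inv_littleo (U r : {poly R[i]}) : (0 < p)%N ->
  ('X * U) \Po ('X * Q) = 'X + 'X^(p.+1) * r ->
  littleo_pow R (Dom rho) (fun z => Psi_inv rho z - ('X * U).[z]) p.
Proof.
move=> p0 UQ; have [K [r0 [K0 r00 hK]]] := Psi_inv_linear_bound p0.
set T := 'X * U; set P := 'X * Q.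
have [B [B0 hB]] := poly_bounded _ P 1.
(* The disc of radius [r0 + B] contains both z and P(w). *)
have [L [L0 hL]] := poly_lipschitz _ T (r0 + B).
have o1 : littleo_pow R (Dom rho) (fun z => T.[P.[Psi_inv rho z]] - T.[z]) (p - 0).
  apply: (littleo_pow_le _ _ _ _ _ (Psi_inv rho) (K + L) r0 0 p _ r00 Psi_littleo _ Dom_neq0) => //.
    exact: addr_ge0.
  move=> z Dz zr; have [w0 wz] := Psi_invP _ Dz; have [w1 wK] := hK z Dz zr.
  split=> //; first by rewrite (le_trans wK) // ler_wpM2r ?cnorm_ge0 // lerDl.
  rewrite expr0 mulr1 wz -/P -[cnorm (z - _)]cnormN opprB.
  apply: (@le_trans _ _ (L * cnorm (P.[Psi_inv rho z] - z))).
    apply: hL; first by rewrite (le_trans (hB _ w1)) // lerDr ltW.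
    by rewrite (le_trans (ltW zr)) // lerDl.
  by rewrite ler_wpM2r ?cnorm_ge0 // lerDr.
have o2 : littleo_pow R (Dom rho) (fun z => Psi_inv rho z - T.[P.[Psi_inv rho z]]) (p - 0).
  apply: (littleo_pow_le _ _ _ _ _ (Psi_inv rho) (K + 1) r0 0 p _ r00
    (littleo_pow_poly _ [set z | complex.Re z < 0] r p) _ Dom_neq0) => //.
    exact: addr_ge0.
  move=> z Dz zr; have [w0 wz] := Psi_invP _ Dz; have [w1 wK] := hK z Dz zr.
  split=> //; first by rewrite (le_trans wK) // ler_wpM2r ?cnorm_ge0 // lerDl.
  rewrite -horner_comp UQ hornerD hornerX hornerM hornerXn opprD addNKr cnormN expr0 mulr1.
  by rewrite ler_peMl ?cnorm_ge0 // lerDr.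
rewrite subn0 in o1 o2; move=> e e0; have [d [d0 hd]] := littleo_powD _ _ _ _ _ o1 o2 e e0.
exists d; split=> // z Dz zd; have := hd z Dz zd.
by rewrite addrC addrA subrK.
Qed.

End Psi_asymptotics.

(** * Passage to the S- and Sigma-transforms *)

Lemma littleo_pow_take (R : realType) (A : set R[i]) (f : R[i] -> R[i]) (V : {poly R[i]}) (n : nat) :
  littleo_pow R A (fun z => f z - V.[z]) n ->
  littleo_pow R A (fun z => f z - \sum_(k < n.+1) V`_k * z ^+ k) n.
Proof.
move=> fo e e0.
have [d [d0 hd]] := littleo_powD _ _ _ _ _ fo (littleo_pow_poly _ A (drop_poly n.+1 V) n) e e0.
exists d; split=> // z Az zd; have := hd z Az zd.
rewrite -{1}[V](poly_take_drop n.+1) hornerD hornerM hornerXn.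
rewrite [X in cnorm X](_ : _ = f z - (take_poly n.+1 V).[z]); last by ring.
by rewrite /take_poly horner_poly.
Qed.

(** The inner polynomial is X + O(X^2), which alters [V] only from degree 2 on. Hence sigma_0 = s_0
    and sigma_1 = s_1. *)
Lemma coef_comp_poly01 (R : comNzRingType) (V G : {poly R}) : G`_0 = 1 ->
  (V \Po ('X * G))`_0 = V`_0 /\ (V \Po ('X * G))`_1 = V`_1.
Proof.
move=> G0; have [W [v0 [v1 ->]]] : exists W v0 v1, V = (W * 'X + v1%:P) * 'X + v0%:P.
  elim/poly_ind: V => [|V c _]; first by exists 0, 0, 0; rewrite !(mul0r, add0r, polyC0).
  elim/poly_ind: V => [|V b _]; last by exists V, c, b.
  by exists 0, c, 0; rewrite !(mul0r, add0r, polyC0).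
rewrite comp_poly_MXaddC comp_poly_MXaddC.
rewrite !coefD !coefC !coefMX /= !coefD !coefC !coefMX /=.
by rewrite [_ * ('X * G)]mulrCA !coefXM /= coef0M coefD coefC [_ * ('X * G)]mulrCA coefXM /= G0 mulr1 !add0r addr0.
Qed.

Lemma cnorm_1B_ge (R : realType) (z : R[i]) : cnorm z <= 1 / 2 ->
  1 / 2 <= cnorm (1 - z).
Proof. by move=> z2; have := cnorm_ler_dist _ 1 z; rewrite cnorm1; lra. Qed.

Section transforms.
Variables (R : realType) (rho : probability R R) (n : nat) (U : {poly R[i]}).
Hypothesis Dom0 : forall z, Dom rho z -> z != 0.
Hypothesis inv_littleo :
  littleo_pow R (Dom rho) (fun z => Psi_inv rho z - ('X * U).[z]) n.+1.

Let V := (1 + 'X) * U.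

(** Multiplied by z, the error becomes z + 1 times the error on [Psi_inv]. Dividing by z again costs
    one order, and |z + 1| <= 2 on the unit disc. *)
Lemma S_transform_littleo :
  littleo_pow R (Dom rho) (fun z => S_transform rho z - V.[z]) n.
Proof.
have := @littleo_pow_le R (Dom rho) (Dom rho) _ (fun z => S_transform rho z - V.[z])
  id 2 1 1 n.+1 (ler0n _ 2) ltr01 inv_littleo.
rewrite subSS subn0; apply=> // z Dz z1; have z0 := Dom0 z Dz.
split=> //; first by rewrite ler_peMl ?cnorm_ge0 // ler1n.
rewrite expr1 -cnormM.
have -> : (S_transform rho z - V.[z]) * z = (z + 1) * (Psi_inv rho z - ('X * U).[z]).
  by rewrite /S_transform /V !hornerM hornerD hornerX hornerC; field.
rewrite cnormM ler_wpM2r ?cnorm_ge0 // (le_trans (cnormD _ _ _)) // cnorm1; lra.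
Qed.

(** The Taylor polynomial X + ... + X^n of z/(1-z), with remainder z^(n+1)/(1-z). *)
Let Y : {poly R[i]} := 'X * \sum_(k < n) 'X^k.

(** Two errors are added: [o1] substitutes z/(1-z) into the expansion of S, and [o2] replaces
    z/(1-z) by [Y] inside [V]. *)
Lemma Sigma_transform_littleo :
  littleo_pow R [set z | Dom rho (z / (1 - z))]
    (fun z => Sigma_transform rho z - (V \Po Y).[z]) n.
Proof.
pose B := [set z : R[i] | Dom rho (z / (1 - z))].
have B0 z : B z -> z != 0.
  by move=> /Dom0; apply: contra_neq => ->; rewrite mul0r.
have h2 : (0 : R) < 1 / 2 by lra.
have hle (z : R[i]) : cnorm z <= 1 / 2 -> cnorm (z / (1 - z)) <= 2 * cnorm z.
  move=> z2; have h := cnorm_1B_ge _ _ z2; rewrite cnormM cnormV.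
  rewrite ler_pdivrMr; last by lra.
  by have := cnorm_ge0 _ z; nra.
have o1 : littleo_pow R B (fun z => Sigma_transform rho z - V.[z / (1 - z)]) (n - 0).
  apply: (@littleo_pow_le R (Dom rho) B _ _ (fun z => z / (1 - z)) 2 (1 / 2) 0 n
    (ler0n _ 2) h2 S_transform_littleo) => // z Bz z2.
  split=> //; first exact/hle/ltW.
  by rewrite expr0 mulr1 ler_peMl ?cnorm_ge0 // ler1n.
have [M [M0 hM]] := poly_bounded _ Y 1.
have [L [L0 hL]] := poly_lipschitz _ V (1 + M).
(* In the constant [1 + L * 2], 2 bounds 1/|1-z| and [L] is the Lipschitz constant of [V]; the
   summand 1 covers h = id. The comparison function is z^(n+1). *)
have o2 : littleo_pow R B (fun z => V.[z / (1 - z)] - (V \Po Y).[z]) (n - 0).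
  apply: (@littleo_pow_le R B B _ _ id (1 + L * 2) (1 / 2) 0 n _ h2
    (littleo_pow_poly R B 1 n)) => //; first by rewrite addr_ge0 ?mulr_ge0.
  move=> z Bz z2; have hz := cnorm_1B_ge _ _ (ltW z2).
  have L20 : 0 <= L * 2 by rewrite mulr_ge0.
  split=> //; first by rewrite ler_peMl ?cnorm_ge0 // lerDl.
  have z1 : 1 - z != 0 by rewrite -cnorm_gt0; lra.
  have hY : z / (1 - z) - Y.[z] = z ^+ n.+1 / (1 - z).
    rewrite /Y hornerM hornerX horner_sum.
    under eq_bigr do rewrite hornerXn.
    have hs : (1 - z) * (\sum_(i < n) z ^+ i) = 1 - z ^+ n.
      by rewrite -{2}(expr1n _ n) subrXX; congr (_ * _); apply: eq_bigr => i _; rewrite expr1n mul1r.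
    apply: (mulIf z1); rewrite mulrBl !divfK // exprS -mulrA [_ * (1 - z)]mulrC hs; ring.
  rewrite expr0 mulr1 horner_comp hornerC mulr1.
  apply: (@le_trans _ _ (L * cnorm (z / (1 - z) - Y.[z]))).
    apply: hL.
      by rewrite (le_trans (hle _ (ltW z2))) //; lra.
    by rewrite (le_trans (hM _ _)) ?lerDr //; lra.
  rewrite hY cnormM cnormV.
  have hi : (cnorm (1 - z))^-1 <= 2 by rewrite invf_ple ?posrE //; lra.
  have hn := cnorm_ge0 _ (z ^+ n.+1).
  have : cnorm (z ^+ n.+1) * (cnorm (1 - z))^-1 <= cnorm (z ^+ n.+1) * 2 by rewrite ler_wpM2l.
  by move=> /(ler_wpM2l L0); lra.
rewrite subn0 in o1 o2; move=> e e0; have [d [d0 hd]] := littleo_powD _ _ _ _ _ o1 o2 e e0.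
exists d; split=> // z Dz zd; have := hd z Dz zd.
by rewrite addrA subrK.
Qed.

End transforms.

(** * Identification of the coefficients *)

Theorem theorem8 (R : realType) (rho : probability R R)
  (rho_supp : rho [set x : R | x < 0] = 0%E)
  (rho_ndirac : ~ (forall A : set R, measurable A -> rho A = @dirac _ R (0 : R) R A))
  (p : nat) (hp : (2 <= p)%N)
  (hmom : forall k : nat, (k <= p)%N ->
     (\int[rho]_(x in `[0%R, +oo[%classic) (x ^+ k)%:E < +oo)%E) :
  (exists s : nat -> R[i],
     [/\ s 0%N = ((mom rho 1)^-1)%:C,
         s 1%N = ((mom rho 1)^-1 - mom rho 2 / mom rho 1 ^+ 3)%:C,
         s 1%N = (- Var_rho rho / mom rho 1 ^+ 3)%:C &
         forall eps : R, 0 < eps -> exists delta : R, 0 < delta /\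
           forall z : R[i], Dom rho z -> cnorm z < delta ->
             cnorm (S_transform rho z - \sum_(k < p) s k * z ^+ k)
               <= eps * cnorm z ^+ (p.-1)]) /\
  (exists sigma : nat -> R[i],
     [/\ sigma 0%N = ((mom rho 1)^-1)%:C,
         sigma 1%N = ((mom rho 1)^-1 - mom rho 2 / mom rho 1 ^+ 3)%:C,
         sigma 1%N = (- Var_rho rho / mom rho 1 ^+ 3)%:C &
         forall eps : R, 0 < eps -> exists delta : R, 0 < delta /\
           forall z : R[i], Dom rho (z / (1 - z)) -> cnorm z < delta ->
             cnorm (Sigma_transform rho z - \sum_(k < p) sigma k * z ^+ k)
               <= eps * cnorm z ^+ (p.-1)]).
Proof.
(* With p = n+2, inversion modulo X^(n+3) is inversion modulo X^(p+1), and the final order p-1 is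
   n+1. *)
case: p hp hmom => [|[|n]] // _ {}hmom.
pose Q := moment_poly R rho n.+2.
have m0 : 0 < mom rho 1 by exact: (@mom1_gt0 _ _ n.+2).
have Q0 : Q`_0 = (mom rho 1)%:C by rewrite coef_poly.
have Q1 : Q`_1 = (mom rho 2)%:C by rewrite coef_poly.
have Q0n : Q`_0 != 0 by rewrite Q0 -(rmorph0 (real_complex R)) (inj_eq (fmorph_inj _)) gt_eqF.
have [U [r [U0 U1 UQ]]] := poly_inverse_mod _ Q n Q0n.
have D0 := @Dom_neq0 _ rho n.+2 hmom rho_supp rho_ndirac.
have Io := Psi_inv_littleo _ _ _ hmom rho_supp rho_ndirac U r isT UQ.
(* The factor z + 1 of S adds consecutive coefficients of [U], so s_1 = 1/m_1 - m_2/m_1^3. *)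
pose V := (1 + 'X) * U.
have V0 : V`_0 = ((mom rho 1)^-1)%:C.
  by rewrite /V mulrDl mul1r coefD coefXM addr0 U0 Q0 fmorphV.
have V1 : V`_1 = ((mom rho 1)^-1 - mom rho 2 / mom rho 1 ^+ 3)%:C.
  rewrite /V mulrDl mul1r coefD coefXM /= U0 U1 Q0 Q1.
  by rewrite rmorphB /= fmorphV fmorph_div rmorphXn /= addrC mulNr.
have Var_eq : (mom rho 1)^-1 - mom rho 2 / mom rho 1 ^+ 3 = - Var_rho rho / mom rho 1 ^+ 3.
  by rewrite /Var_rho; field; rewrite gt_eqF.
have [W0 W1] : (V \Po ('X * \sum_(k < n.+1) 'X^k))`_0 = V`_0 /\
    (V \Po ('X * \sum_(k < n.+1) 'X^k))`_1 = V`_1.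
  apply: coef_comp_poly01; rewrite coef_sum big_ord_recl coefXn big1 ?addr0 // => i _.
  by rewrite coefXn.
split.
- exists (fun k => V`_k); split; rewrite -?Var_eq //.
  exact: littleo_pow_take (S_transform_littleo _ _ _ _ D0 Io).
- exists (fun k => (V \Po ('X * \sum_(k < n.+1) 'X^k))`_k).
  split; rewrite -?Var_eq ?W0 ?W1 //.
  exact: littleo_pow_take (Sigma_transform_littleo _ _ _ _ D0 Io).
Qed.
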